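(* Suppose that $0\le\tilde m_1(t)\le 1$ on $[0,T]$ and that, for each $j=0,\dots,n$, $\tilde m_2$ is constant on $[t_j,t_{j+1}]$, equal to the average of $m_2$ on $[t_j,t_{j+1}]$. Assume moreover that for each $j=0,\dots,n$ the restriction of $m_1$ to $[t_j,t_{j+1}]$ is concave and the restriction of $m_2$ to $[t_j,t_{j+1}]$ is convex. Then, for $k=0,\dots,n$, $$\frac{|F(t_k)-\tilde F(t_k)|}{A}\le \int_0^{t_k}|m_1(s)-\tilde m_1(s)|\,\mathrm{d}s+t_k\int_0^{t_k}|m_2(s)-\tilde m_2(s)|\,\mathrm{d}s.$$
   Context: Let $0=t_0<t_1<\dots<t_n<t_{n+1}=T$, where $t_0,\dots,t_n$ are impulse times, $\eta_i\in[0,1]$ amplitudes, and $\tau_c,\bar R,A,K_m,\tau_1,\tau_2>0$ constants. Set $R_0=1$, $R_i=1+(\bar R-1)e^{-(t_i-t_{i-1})/\tau_c}$ for $i\ge1$, and $c_N(t)=\frac1{\tau_c}\sum_{i=0}^n R_i\eta_i(t-t_i)e^{-(t-t_i)/\tau_c}H(t-t_i)$ with $H$ the Heaviside function. Define $$m_1(t)=\frac{c_N(t)}{K_m+c_N(t)},\qquad m_2(t)=\frac1{\tau_1+\tau_2m_1(t)}.$$ The force $F$ is the solution of $\dot F=-m_2F+m_1A$, $F(0)=0$, i.e. $F(t)=A\int_0^t M(t)M^{-1}(s)m_1(s)\,\mathrm{d}s$ with $M(t)=\exp(-\int_0^t m_2(s)\,\mathrm{d}s)$ and $M^{-1}=1/M$.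 Its approximation is $$\tilde F(t)=A\int_0^t\tilde M(t)\tilde M^{-1}(s)\tilde m_1(s)\,\mathrm{d}s,\qquad \tilde M(t)=\exp\left(-\int_0^t\tilde m_2(s)\,\mathrm{d}s\right),$$ where $\tilde m_1,\tilde m_2$ are piecewise polynomial approximations of $m_1,m_2$ on $[0,T]$, with respect to a finite partition refining $(t_i)_{0\le i\le n+1}$. *)

(* Defs.v *)
(* Stdlib reals with Coquelicot. *)
From Stdlib Require Import Reals.
From Coquelicot Require Import Coquelicot.
Open Scope R_scope.

(* Only t 0, ..., t (S n) are meaningful: t 0, ..., t n are the impulse times
   and t (S n) = T is the final time. *)
Definition time_grid (n : nat) (T : R) (t : nat -> R) : Prop :=
  t 0%nat = 0 /\ t (S n) = T /\ forall i : nat, (i <= n)%nat -> t i < t (S i).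

Definition Heaviside (x : R) : R := if Rle_dec 0 x then 1 else 0.

(* The R_i; [rbar] is the constant \bar R. *)
Definition scaling (tauc rbar : R) (t : nat -> R) (i : nat) : R :=
  match i with
  | O => 1
  | S j => 1 + (rbar - 1) * exp (- (t (S j) - t j) / tauc)
  end.

Definition c_N (tauc rbar : R) (n : nat) (t eta : nat -> R) (x : R) : R :=
  1 / tauc *
  sum_f_R0 (fun i => scaling tauc rbar t i * eta i * (x - t i)
                     * exp (- (x - t i) / tauc) * Heaviside (x - t i)) n.

Definition m_1 (tauc rbar Km : R) (n : nat) (t eta : nat -> R) (x : R) : R :=
  c_N tauc rbar n t eta x / (Km + c_N tauc rbar n t eta x).

Definition m_2 (tauc rbar Km tau1 tau2 : R) (n : nat) (t eta : nat -> R)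
  (x : R) : R :=
  1 / (tau1 + tau2 * m_1 tauc rbar Km n t eta x).

(* F' = - m2 F + m1 A on [0, T] with F 0 = 0. The values of F outside [0, T]
   are irrelevant; the one-sided equations at 0 and T follow by continuity
   when m1 and m2 are continuous. *)
Definition is_force (A T : R) (m1 m2 F : R -> R) : Prop :=
  F 0 = 0 /\
  continuous_on (fun x => 0 <= x <= T) F /\
  forall x : R, 0 < x < T -> is_derive F x (- m2 x * F x + m1 x * A).

Definition decay (m2 : R -> R) (x : R) : R := exp (- RInt m2 0 x).

Definition force_formula (A : R) (m1 m2 : R -> R) (x : R) : R :=
  A * RInt (fun s => decay m2 x * / decay m2 s * m1 s) 0 x.

(* s 0 < ... < s p is a partition of [0, T] containing t 0, ..., t (S n). *)
Definition refining_partition (n : nat) (T : R) (t : nat -> R)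
  (p : nat) (s : nat -> R) : Prop :=
  s 0%nat = 0 /\ s p = T /\
  (forall l : nat, (l < p)%nat -> s l < s (S l)) /\
  (forall i : nat, (i <= S n)%nat -> exists l : nat, (l <= p)%nat /\ s l = t i).

(* Pieces are taken on open subintervals: no convention is imposed on the
   values at the breakpoints, where the function may jump. *)
Definition piecewise_polynomial (p : nat) (s : nat -> R) (f : R -> R) : Prop :=
  forall l : nat, (l < p)%nat ->
  exists (d : nat) (a : nat -> R),
  forall x : R, s l < x < s (S l) -> f x = sum_f_R0 (fun k => a k * x ^ k) d.

Definition average (f : R -> R) (a b : R) : R := RInt f a b / (b - a).

Definition convex_on (a b : R) (f : R -> R) : Prop :=
  forall x y lam : R, a <= x <= b -> a <= y <= b -> 0 <= lam <= 1 ->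
  f (lam * x + (1 - lam) * y) <= lam * f x + (1 - lam) * f y.

Definition concave_on (a b : R) (f : R -> R) : Prop :=
  forall x y lam : R, a <= x <= b -> a <= y <= b -> 0 <= lam <= 1 ->
  lam * f x + (1 - lam) * f y <= f (lam * x + (1 - lam) * y).

(* Main.v *)
Require Import Defs.
From Stdlib Require Import Reals Lra Lia.
From Coquelicot Require Import Coquelicot.
Open Scope R_scope.

(** Write [E x s] for the factor [M x / M s = exp (- int_s^x m2)], which lies
    in the unit interval because [m2 >= 0], and [E' x s] for its approximation, which
    lies there too because the averages of [m2] are nonnegative.  Both forces
    are [A] times the integral of the input against this factor, and

      [E m1 - E' m1' = E (m1 - m1') + (E - E') m1'].

    The first term is at most [|m1 - m1'|].  For the second, [0 <= m1' <= 1]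
    and [exp (- _)] is 1-Lipschitz on the nonnegative half-line, so it is at
    most [|int_s^x (m2 - m2')| <= int_0^x |m2 - m2'|], a quantity independent
    of [s].  Integrating in [s] from 0 to [x] gives the bound
    ([force_formula_stability]).

    Three points remain.  The force, given as a solution of the differential
    equation, equals its integral formula: [F / M] and the primitive of
    [A m1 / M] have the same derivative ([is_force_unique]).  All integrands
    are Riemann integrable: functions that agree on each open piece of a
    partition with a continuous function are integrable and closed under
    products, continuous post-composition and primitives.  Finally [m1] and
    [m2] are continuous and nonnegative, since [(x - t_i) H(x - t_i)] is the
    positive part of [x - t_i] and each [R_i] is a convex combination of
    1 and [rbar], both positive. *)

(** * Primitives and partitions *)

Lemma ex_RInt_of_continuous (f : R -> R) (a b : R) :
  (forall x : R, continuous f x) -> ex_RInt f a b.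
Proof. intros Hf. apply (ex_RInt_continuous f). intros z _. apply Hf. Qed.

Lemma is_derive_primitive (f : R -> R) (a x : R) :
  (forall x : R, continuous f x) -> is_derive (RInt f a) x (f x).
Proof.
  intros Hf. apply (is_derive_RInt f (RInt f a) a x).
  - apply filter_forall. intros y. apply (RInt_correct f).
    now apply ex_RInt_of_continuous.
  - apply Hf.
Qed.

Lemma continuous_primitive (f : R -> R) (a x : R) :
  (forall x : R, continuous f x) -> continuous (RInt f a) x.
Proof.
  intros Hf. apply (ex_derive_continuous (RInt f a)). exists (f x).
  now apply is_derive_primitive.
Qed.

Lemma RInt_Chasles_R (f : R -> R) (a b c : R) :
  ex_RInt f a b -> ex_RInt f b c -> RInt f a b + RInt f b c = RInt f a c.
Proof. intros H1 H2. exact (RInt_Chasles f a b c H1 H2). Qed.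

Lemma ex_RInt_sub (f : R -> R) (a b c d : R) :
  a <= b <= c -> c <= d -> ex_RInt f a d -> ex_RInt f b c.
Proof.
  intros Hb Hc H. apply (ex_RInt_Chasles_1 f) with d; [lra|].
  apply (ex_RInt_Chasles_2 f) with a; [lra|exact H].
Qed.

Lemma grid_le (p : nat) (s : nat -> R) :
  (forall l : nat, (l < p)%nat -> s l < s (S l)) ->
  forall i j : nat, (i <= j <= p)%nat -> s i <= s j.
Proof.
  intros Hs i j. induction j as [|j IH]; intros Hij.
  - replace i with 0%nat by lia. lra.
  - destruct (Nat.eq_dec i (S j)) as [->|Hne]; [lra|].
    assert (s i <= s j) by (apply IH; lia).
    assert (s j < s (S j)) by (apply Hs; lia). lra.
Qed.

(** Sign information on the open pieces only is enough, so that the values of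
    [f] at the breakpoints of the grid are left free. *)
Lemma RInt_ge_0_grid (p : nat) (s : nat -> R) (f : R -> R) :
  (forall l : nat, (l < p)%nat -> s l < s (S l)) ->
  ex_RInt f (s 0%nat) (s p) ->
  (forall l : nat, (l < p)%nat -> forall x : R, s l < x < s (S l) -> 0 <= f x) ->
  forall (l : nat) (u : R), (l <= p)%nat -> s 0%nat <= u <= s l ->
  0 <= RInt f u (s l).
Proof.
  intros Hs Hf Hpos l. induction l as [|l IH]; intros u Hl Hu.
  - replace u with (s 0%nat) by lra. rewrite RInt_point. apply Rle_refl.
  - assert (H0 : s 0%nat <= s l) by (apply (grid_le p); [exact Hs|lia]).
    assert (H1 : s l < s (S l)) by (apply Hs; lia).
    assert (H2 : s (S l) <= s p) by (apply (grid_le p); [exact Hs|lia]).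
    destruct (Rle_dec u (s l)) as [Hul|Hul].
    + rewrite <- (RInt_Chasles_R f u (s l) (s (S l))).
      * apply Rplus_le_le_0_compat; [apply IH; [lia|lra]|].
        apply RInt_ge_0; [lra| |apply Hpos; lia].
        apply ex_RInt_sub with (s 0%nat) (s p); [lra|lra|exact Hf].
      * apply ex_RInt_sub with (s 0%nat) (s p); [lra|lra|exact Hf].
      * apply ex_RInt_sub with (s 0%nat) (s p); [lra|lra|exact Hf].
    + apply RInt_ge_0; [lra| |].
      * apply ex_RInt_sub with (s 0%nat) (s p); [lra|lra|exact Hf].
      * intros x Hx. apply (Hpos l); [lia|lra].
Qed.

(** * Piecewise continuous functions *)

(** Each piece extends to a continuous function on the whole line: this makes
    the one-sided limits at the breakpoints finite, and spares any discussion
    of one-sided continuity. *)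
Definition piecewise_continuous (p : nat) (s : nat -> R) (f : R -> R) : Prop :=
  forall l : nat, (l < p)%nat ->
  exists g : R -> R, (forall x : R, continuous g x) /\
    forall x : R, s l < x < s (S l) -> f x = g x.

Lemma continuous_piecewise (p : nat) (s : nat -> R) (f : R -> R) :
  (forall x : R, continuous f x) -> piecewise_continuous p s f.
Proof. intros Hf l _. exists f. auto. Qed.

Lemma continuous_polynomial (a : nat -> R) (d : nat) (x : R) :
  continuous (fun x : R => sum_f_R0 (fun k => a k * x ^ k) d) x.
Proof.
  apply continuity_pt_filterlim.
  exact (continuity_finite_sum a d x).
Qed.

Lemma piecewise_polynomial_continuous (p : nat) (s : nat -> R) (f : R -> R) :
  piecewise_polynomial p s f -> piecewise_continuous p s f.
Proof.
  intros Hf l Hl. destruct (Hf l Hl) as (d & a & Ha).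
  exists (fun x => sum_f_R0 (fun k => a k * x ^ k) d). split; [|exact Ha].
  intros x. apply continuous_polynomial.
Qed.

Lemma piecewise_continuous_comp (p : nat) (s : nat -> R) (h f : R -> R) :
  (forall x : R, continuous h x) -> piecewise_continuous p s f ->
  piecewise_continuous p s (fun x => h (f x)).
Proof.
  intros Hh Hf l Hl. destruct (Hf l Hl) as (g & Hg & Hfg).
  exists (fun x => h (g x)). split.
  - intros x. apply (continuous_comp g h); auto.
  - intros x Hx. now rewrite Hfg.
Qed.

Lemma piecewise_continuous_mult (p : nat) (s : nat -> R) (f1 f2 : R -> R) :
  piecewise_continuous p s f1 -> piecewise_continuous p s f2 ->
  piecewise_continuous p s (fun x => f1 x * f2 x).
Proof.
  intros H1 H2 l Hl.
  destruct (H1 l Hl) as (g1 & Hg1 & Hf1). destruct (H2 l Hl) as (g2 & Hg2 & Hf2).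
  exists (fun x => g1 x * g2 x). split.
  - intros x. apply (continuous_mult g1 g2); auto.
  - intros x Hx. now rewrite Hf1, Hf2.
Qed.

Lemma piecewise_continuous_ex_RInt (p : nat) (s : nat -> R) (f : R -> R) :
  (forall l : nat, (l < p)%nat -> s l < s (S l)) ->
  piecewise_continuous p s f ->
  forall l : nat, (l <= p)%nat -> ex_RInt f (s 0%nat) (s l).
Proof.
  intros Hs Hf l. induction l as [|l IH]; intros Hl.
  - apply ex_RInt_point.
  - apply (ex_RInt_Chasles f) with (s l); [apply IH; lia|].
    destruct (Hf l ltac:(lia)) as (g & Hg & Hfg).
    assert (H1 : s l < s (S l)) by (apply Hs; lia).
    apply ex_RInt_ext with g.
    + intros x Hx. rewrite Rmin_left, Rmax_right in Hx by lra.
      symmetry. now apply Hfg.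
    + now apply ex_RInt_of_continuous.
Qed.

Lemma piecewise_continuous_primitive (p : nat) (s : nat -> R) (f : R -> R) :
  (forall l : nat, (l < p)%nat -> s l < s (S l)) ->
  piecewise_continuous p s f ->
  piecewise_continuous p s (RInt f (s 0%nat)).
Proof.
  intros Hs Hf l Hl. destruct (Hf l Hl) as (g & Hg & Hfg).
  assert (H1 : s l < s (S l)) by (apply Hs; lia).
  exists (fun x => RInt f (s 0%nat) (s l) + RInt g (s l) x). split.
  - intros x. apply (continuous_plus (fun _ => RInt f (s 0%nat) (s l)) (RInt g (s l))).
    + apply continuous_const.
    + now apply continuous_primitive.
  - intros x Hx.
    assert (Heq : forall y, Rmin (s l) x < y < Rmax (s l) x -> g y = f y).
    { intros y Hy. rewrite Rmin_left, Rmax_right in Hy by lra.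
      symmetry. apply Hfg. lra. }
    rewrite (RInt_ext g f) by exact Heq.
    symmetry. apply RInt_Chasles_R.
    + apply piecewise_continuous_ex_RInt with p; [exact Hs|exact Hf|lia].
    + apply ex_RInt_ext with g; [exact Heq|]. now apply ex_RInt_of_continuous.
Qed.

(** * Stability of the force formula *)

Lemma exp_nonpos_le_1 (a : R) : a <= 0 -> exp a <= 1.
Proof.
  intros [Ha | ->]; [|rewrite exp_0; lra].
  rewrite <- exp_0. now apply Rlt_le, exp_increasing.
Qed.

Lemma exp_neg_lipschitz (a b : R) :
  0 <= a -> 0 <= b -> Rabs (exp (- a) - exp (- b)) <= Rabs (a - b).
Proof.
  assert (H : forall a b, 0 <= a <= b -> 0 <= exp (- a) - exp (- b) <= b - a).
  { clear a b. intros a b Hab.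
    replace (- b) with (- a + - (b - a)) by ring. rewrite exp_plus.
    assert (H1 := exp_ineq1_le (- (b - a))).
    assert (H2 : exp (- (b - a)) <= 1)
      by (apply exp_nonpos_le_1; lra).
    assert (H3 : exp (- a) <= 1)
      by (apply exp_nonpos_le_1; lra).
    assert (H4 := exp_pos (- a)). nra. }
  intros Ha Hb. destruct (Rle_dec a b) as [Hab|Hab].
  - assert (H1 := H a b ltac:(lra)).
    rewrite Rabs_pos_eq, Rabs_minus_sym, Rabs_pos_eq; lra.
  - assert (H1 := H b a ltac:(lra)).
    rewrite Rabs_minus_sym, Rabs_pos_eq, Rabs_pos_eq; lra.
Qed.

(** Two exponentials cancel up to the time [s], so only the integral from [s]
    to [x] survives; its sign then decides whether the factor is at most 1. *)
Lemma decay_ratio (m : R -> R) (s x : R) :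
  ex_RInt m 0 s -> ex_RInt m s x ->
  decay m x * / decay m s = exp (- RInt m s x).
Proof.
  intros H1 H2. unfold decay. rewrite <- (RInt_Chasles_R m 0 s x) by assumption.
  rewrite <- exp_Ropp, <- exp_plus. f_equal. ring.
Qed.

Lemma piecewise_continuous_force_integrand
  (p : nat) (s : nat -> R) (m1 m2 : R -> R) (x : R) :
  (forall l : nat, (l < p)%nat -> s l < s (S l)) -> s 0%nat = 0 ->
  piecewise_continuous p s m1 -> piecewise_continuous p s m2 ->
  piecewise_continuous p s (fun u => decay m2 x * / decay m2 u * m1 u).
Proof.
  intros Hs H0 H1 H2. apply piecewise_continuous_mult; [|exact H1].
  apply (piecewise_continuous_comp p s
           (fun v => decay m2 x * / exp (- v)) (RInt m2 0)).
  - intros v. apply (continuous_mult (fun _ => decay m2 x) (fun v => / exp (- v))).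
    + apply continuous_const.
    + apply continuous_Rinv_comp.
      * apply continuous_exp_comp. apply (continuous_opp (fun v : R => v)).
        apply continuous_id.
      * apply Rgt_not_eq, exp_pos.
  - rewrite <- H0. now apply piecewise_continuous_primitive.
Qed.

(** The right-hand side depends on [u] only through [m1 - m1'], so that
    integrating in [u] multiplies the error on [m2] by the length [x]. *)
Lemma force_integrand_stability (m1 m2 m1' m2' : R -> R) (x u : R) :
  0 <= u <= x ->
  ex_RInt m2 0 x -> ex_RInt m2' 0 x ->
  0 <= RInt m2 u x -> 0 <= RInt m2' u x -> 0 <= m1' u <= 1 ->
  Rabs (decay m2 x * / decay m2 u * m1 u - decay m2' x * / decay m2' u * m1' u)
  <= Rabs (m1 u - m1' u) + RInt (fun v => Rabs (m2 v - m2' v)) 0 x.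
Proof.
  intros Hu I2 I2' P2 P2' B.
  assert (I2u : ex_RInt m2 u x) by (apply ex_RInt_sub with 0 x; [lra|lra|exact I2]).
  assert (I2'u : ex_RInt m2' u x) by (apply ex_RInt_sub with 0 x; [lra|lra|exact I2']).
  assert (Id : ex_RInt (fun v => m2 v - m2' v) 0 x) by exact (ex_RInt_minus m2 m2' 0 x I2 I2').
  assert (Ia : ex_RInt (fun v => Rabs (m2 v - m2' v)) 0 x)
    by exact (ex_RInt_norm _ 0 x Id).
  rewrite !decay_ratio;
    try assumption;
    try (apply ex_RInt_sub with 0 x; [lra|lra|assumption]).
  set (e := exp (- RInt m2 u x)). set (e' := exp (- RInt m2' u x)).
  assert (He : 0 <= e <= 1).
  { split; [apply Rlt_le, exp_pos|]. apply exp_nonpos_le_1. lra. }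
  assert (Hee : Rabs (e - e') <= RInt (fun v => Rabs (m2 v - m2' v)) 0 x).
  { apply Rle_trans with (1 := exp_neg_lipschitz _ _ P2 P2').
    replace (RInt m2 u x - RInt m2' u x) with (RInt (fun v => m2 v - m2' v) u x)
      by exact (RInt_minus m2 m2' u x I2u I2'u).
    apply Rle_trans with (RInt (fun v => Rabs (m2 v - m2' v)) u x).
    - apply abs_RInt_le; [lra|]. apply ex_RInt_sub with 0 x; [lra|lra|exact Id].
    - rewrite <- (RInt_Chasles_R _ 0 u x).
      + assert (0 <= RInt (fun v => Rabs (m2 v - m2' v)) 0 u); [|lra].
        apply RInt_ge_0; [lra| |intros; apply Rabs_pos].
        apply ex_RInt_sub with 0 x; [lra|lra|exact Ia].
      + apply ex_RInt_sub with 0 x; [lra|lra|exact Ia].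
      + apply ex_RInt_sub with 0 x; [lra|lra|exact Ia]. }
  replace (e * m1 u - e' * m1' u) with (e * (m1 u - m1' u) + (e - e') * m1' u) by ring.
  apply Rle_trans with (1 := Rabs_triang _ _). rewrite !Rabs_mult.
  rewrite (Rabs_pos_eq e), (Rabs_pos_eq (m1' u)) by lra.
  assert (H1 := Rabs_pos (m1 u - m1' u)). assert (H2 := Rabs_pos (e - e')). nra.
Qed.

Lemma force_formula_stability
  (p : nat) (s : nat -> R) (A x : R) (m1 m2 m1' m2' : R -> R) :
  (forall l : nat, (l < p)%nat -> s l < s (S l)) -> s 0%nat = 0 ->
  0 < A -> 0 <= x <= s p ->
  piecewise_continuous p s m1 -> piecewise_continuous p s m2 ->
  piecewise_continuous p s m1' -> piecewise_continuous p s m2' ->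
  (forall u : R, 0 <= u <= x -> 0 <= RInt m2 u x) ->
  (forall u : R, 0 <= u <= x -> 0 <= RInt m2' u x) ->
  (forall u : R, 0 <= u <= x -> 0 <= m1' u <= 1) ->
  Rabs (force_formula A m1 m2 x - force_formula A m1' m2' x) / A
  <= RInt (fun u => Rabs (m1 u - m1' u)) 0 x
     + x * RInt (fun u => Rabs (m2 u - m2' u)) 0 x.
Proof.
  intros Hs H0 HA Hx C1 C2 C1' C2' P2 P2' B.
  assert (Int : forall f, piecewise_continuous p s f -> ex_RInt f 0 x).
  { intros f Cf. apply ex_RInt_sub with 0 (s p); [lra|lra|].
    rewrite <- H0 at 1. now apply piecewise_continuous_ex_RInt with p. }
  assert (Ik := Int _ (piecewise_continuous_force_integrand p s m1 m2 x Hs H0 C1 C2)).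
  assert (Ik' := Int _ (piecewise_continuous_force_integrand p s m1' m2' x Hs H0 C1' C2')).
  assert (Id : ex_RInt (fun u => Rabs (m1 u - m1' u)) 0 x).
  { apply (ex_RInt_norm (fun u => m1 u - m1' u)).
    exact (ex_RInt_minus m1 m1' 0 x (Int _ C1) (Int _ C1')). }
  set (c := RInt (fun u => Rabs (m2 u - m2' u)) 0 x).
  unfold force_formula.
  set (k := fun u => decay m2 x * / decay m2 u * m1 u) in *.
  set (k' := fun u => decay m2' x * / decay m2' u * m1' u) in *.
  rewrite <- Rmult_minus_distr_l, Rabs_mult, (Rabs_pos_eq A) by lra.
  replace (A * Rabs (RInt k 0 x - RInt k' 0 x) / A)
    with (Rabs (RInt k 0 x - RInt k' 0 x)) by (field; lra).
  assert (Ikk : ex_RInt (fun u => k u - k' u) 0 x) by exact (ex_RInt_minus k k' 0 x Ik Ik').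
  replace (RInt k 0 x - RInt k' 0 x) with (RInt (fun u => k u - k' u) 0 x)
    by exact (RInt_minus k k' 0 x Ik Ik').
  apply Rle_trans with (RInt (fun u => Rabs (k u - k' u)) 0 x);
    [apply abs_RInt_le; [lra|exact Ikk]|].
  assert (Ic : ex_RInt (fun _ => c) 0 x) by apply ex_RInt_const.
  apply Rle_trans with (RInt (fun u => Rabs (m1 u - m1' u) + c) 0 x).
  - apply RInt_le; [lra|exact (ex_RInt_norm _ 0 x Ikk)| |].
    + exact (ex_RInt_plus (fun u => Rabs (m1 u - m1' u)) (fun _ => c) 0 x Id Ic).
    + intros u Hu. apply force_integrand_stability; auto; try lra.
      * apply P2. lra.
      * apply P2'. lra.
      * apply B. lra.
  - right.
    etransitivity; [exact (RInt_plus (fun u => Rabs (m1 u - m1' u)) (fun _ => c) 0 x Id Ic)|].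
    rewrite RInt_const. unfold plus, scal; simpl. unfold mult; simpl. ring.
Qed.

(** * Uniqueness of the force *)

(** The differential equation holds on the open interval only, and [F] is
    merely right-continuous at 0; [F (Rmax 0 x)] is continuous on both sides,
    so the mean value theorem applies from 0. *)
Lemma continuous_Rmax_comp (T : R) (F : R -> R) (x : R) :
  continuous_on (fun x => 0 <= x <= T) F -> 0 <= x < T ->
  continuous (fun y => F (Rmax 0 y)) x.
Proof.
  intros HF Hx. unfold continuous.
  assert (HFx := HF x ltac:(lra)).
  rewrite (Rmax_right 0 x) by lra.
  apply (filterlim_comp _ _ _ (fun y => Rmax 0 y) F _ _ _) with (2 := HFx).
  intros P [d HP].
  assert (Hd : 0 < Rmin d (T - x)) by (apply Rmin_pos; [apply cond_pos|lra]).
  exists (mkposreal _ Hd). intros y Hy.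
  change (Rabs (y - x) < Rmin d (T - x)) in Hy.
  assert (Hy1 := Rlt_le_trans _ _ _ Hy (Rmin_l _ _)).
  assert (Hy2 := Rlt_le_trans _ _ _ Hy (Rmin_r _ _)).
  apply Rabs_lt_between in Hy2.
  assert (Hm : 0 <= Rmax 0 y <= T).
  { split; [apply Rmax_l|apply Rmax_lub; lra]. }
  apply HP; [|exact Hm].
  change (Rabs (Rmax 0 y - x) < d). apply Rle_lt_trans with (2 := Hy1).
  unfold Rmax. destruct (Rle_dec 0 y); [apply Rle_refl|].
  rewrite !Rabs_left1; lra.
Qed.

(** With the integrating factor [w = 1 / M], the function [F w] and the
    primitive of [A w m1] have the same derivative and agree at 0. *)
Lemma is_force_unique (A T : R) (m1 m2 F : R -> R) :
  (forall x : R, continuous m1 x) -> (forall x : R, continuous m2 x) ->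
  is_force A T m1 m2 F ->
  forall x : R, 0 <= x < T -> F x = force_formula A m1 m2 x.
Proof.
  intros C1 C2 (F0 & FC & FD) x Hx.
  set (w := fun u => exp (RInt m2 0 u)).
  assert (Dw : forall u, is_derive w u (m2 u * w u)).
  { intros u. apply (is_derive_comp exp (RInt m2 0)).
    - apply is_derive_exp.
    - now apply is_derive_primitive. }
  assert (Cw : forall u, continuous w u).
  { intros u. apply (ex_derive_continuous w). eexists. apply Dw. }
  assert (Cwm : forall u, continuous (fun u => w u * m1 u) u).
  { intros u. apply (continuous_mult w m1); auto. }
  set (J := RInt (fun v => w v * m1 v) 0).
  assert (DJ : forall u, is_derive J u (w u * m1 u)).
  { intros u. exact (is_derive_primitive (fun v => w v * m1 v) 0 u Cwm). }
  set (G := fun u => F (Rmax 0 u) * w u - A * J u).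
  assert (HG : G x = G 0).
  { destruct (MVT_gen G 0 x (fun _ => 0)) as (c & _ & Hc); [| |lra].
    - intros u Hu. rewrite Rmin_left, Rmax_right in Hu by lra.
      apply (is_derive_ext_loc (fun u => F u * w u - A * J u)).
      + exists (mkposreal u (proj1 Hu)). intros y Hy.
        change (Rabs (y - u) < u) in Hy. apply Rabs_lt_between in Hy.
        unfold G. now rewrite Rmax_right by lra.
      + assert (H1 := FD u ltac:(lra)). assert (H2 := Dw u).
        assert (H3 := DJ u).
        assert (H0 : (- m2 u * F u + m1 u * A) * w u + F u * (m2 u * w u)
                     - A * (w u * m1 u) = 0) by ring.
        rewrite <- H0.
        apply (is_derive_minus (fun u => F u * w u) (fun u => A * J u)).
        * exact (is_derive_mult F w u _ _ H1 H2 Rmult_comm).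
        * exact (is_derive_scal J u A _ H3).
    - intros u Hu. rewrite Rmin_left, Rmax_right in Hu by lra.
      apply continuity_pt_filterlim.
      apply (continuous_minus (fun u => F (Rmax 0 u) * w u) (fun u => A * J u)).
      + apply (continuous_mult (fun u => F (Rmax 0 u)) w); [|apply Cw].
        apply continuous_Rmax_comp with T; [exact FC|lra].
      + apply (continuous_scal_r A J).
        apply (ex_derive_continuous J). eexists. apply DJ. }
  assert (J0 : J 0 = 0) by exact (RInt_point 0 (fun v => w v * m1 v)).
  unfold G in HG. rewrite !Rmax_right, J0, F0 in HG by lra.
  unfold force_formula.
  rewrite (RInt_ext _ (fun v => decay m2 x * (w v * m1 v))).
  2:{ intros v _. unfold decay, w. rewrite <- exp_Ropp, Ropp_involutive.
      apply Rmult_assoc. }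
  replace (RInt (fun v => decay m2 x * (w v * m1 v)) 0 x)
    with (decay m2 x * RInt (fun v => w v * m1 v) 0 x)
    by (symmetry; exact (RInt_scal (fun v => w v * m1 v) 0 x (decay m2 x)
                  (ex_RInt_of_continuous _ 0 x Cwm))).
  assert (Hinv : decay m2 x * w x = 1).
  { unfold decay, w. rewrite <- exp_plus, Rplus_opp_l. apply exp_0. }
  replace (F x) with (decay m2 x * w x * F x) by (rewrite Hinv; ring).
  replace (decay m2 x * w x * F x) with (decay m2 x * (F x * w x)) by ring.
  fold J. replace (F x * w x) with (A * J x) by lra. ring.
Qed.

(** * Continuity and positivity of the model coefficients *)

Lemma scaling_pos (tauc rbar : R) (n : nat) (T : R) (t : nat -> R) (i : nat) :
  time_grid n T t -> 0 < tauc -> 0 < rbar -> (i <= n)%nat ->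
  0 < scaling tauc rbar t i.
Proof.
  intros (_ & _ & Ht) Hc Hr Hi. destruct i as [|i]; simpl; [lra|].
  assert (Hlt : t i < t (S i)) by (apply Ht; lia).
  set (e := exp (- (t (S i) - t i) / tauc)).
  assert (He : 0 < e <= 1).
  { split; [apply exp_pos|]. apply exp_nonpos_le_1.
    assert (0 < / tauc) by now apply Rinv_0_lt_compat. unfold Rdiv. nra. }
  nra.
Qed.

Lemma mult_Heaviside (x : R) : x * Heaviside x = Rmax 0 x.
Proof.
  unfold Heaviside, Rmax. destruct (Rle_dec 0 x); lra.
Qed.

Lemma continuous_Rmax_0 (x : R) : continuous (Rmax 0) x.
Proof.
  apply continuous_ext with (fun y => (y + Rabs y) * / 2).
  - intros y. unfold Rmax, Rabs. destruct (Rle_dec 0 y), (Rcase_abs y); lra.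
  - apply (continuous_mult (fun y : R => y + Rabs y) (fun _ => / 2)).
    + apply (continuous_plus (fun y : R => y) Rabs);
        [apply continuous_id|apply continuous_Rabs].
    + apply continuous_const.
Qed.

Lemma continuous_sum_f_R0 (f : nat -> R -> R) (n : nat) (x : R) :
  (forall i : nat, continuous (f i) x) ->
  continuous (fun y => sum_f_R0 (fun i => f i y) n) x.
Proof.
  intros Hf. induction n as [|n IH]; simpl; [apply Hf|].
  apply (continuous_plus (fun y => sum_f_R0 (fun i => f i y) n) (f (S n)));
    [exact IH|apply Hf].
Qed.

Lemma continuous_c_N (tauc rbar : R) (n : nat) (t eta : nat -> R) (x : R) :
  continuous (c_N tauc rbar n t eta) x.
Proof.
  unfold c_N.
  apply (continuous_scal_r (1 / tauc) (fun x : R =>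
    sum_f_R0 (fun i => scaling tauc rbar t i * eta i * (x - t i)
                     * exp (- (x - t i) / tauc) * Heaviside (x - t i)) n)).
  apply (continuous_sum_f_R0 (fun i x => scaling tauc rbar t i * eta i * (x - t i)
                     * exp (- (x - t i) / tauc) * Heaviside (x - t i))).
  intros i.
  apply continuous_ext with (fun y =>
    scaling tauc rbar t i * eta i * exp (- (y - t i) / tauc) * Rmax 0 (y - t i)).
  { intros y. apply (@eq_sym R). rewrite <- mult_Heaviside. ring. }
  apply (continuous_mult
    (fun y => scaling tauc rbar t i * eta i * exp (- (y - t i) / tauc))
    (fun y => Rmax 0 (y - t i))).
  - apply (ex_derive_continuous
      (fun y => scaling tauc rbar t i * eta i * exp (- (y - t i) / tauc))).
    auto_derive. exact I.
  - apply (continuous_comp (fun y => y - t i) (Rmax 0)).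
    + apply (ex_derive_continuous (fun y => y - t i)). auto_derive. exact I.
    + apply continuous_Rmax_0.
Qed.

Lemma c_N_nonneg (tauc rbar T : R) (n : nat) (t eta : nat -> R) (x : R) :
  time_grid n T t -> (forall i : nat, (i <= n)%nat -> 0 <= eta i <= 1) ->
  0 < tauc -> 0 < rbar -> 0 <= c_N tauc rbar n t eta x.
Proof.
  intros Ht He Hc Hr. unfold c_N. apply Rmult_le_pos.
  - apply Rlt_le, Rdiv_lt_0_compat; lra.
  - rewrite <- (sum_eq_R0 (fun _ => 0) n) by reflexivity.
    apply sum_Rle. intros i Hi.
    replace (scaling tauc rbar t i * eta i * (x - t i)
             * exp (- (x - t i) / tauc) * Heaviside (x - t i))
      with (scaling tauc rbar t i * eta i * exp (- (x - t i) / tauc)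
            * Rmax 0 (x - t i)) by (rewrite <- mult_Heaviside; ring).
    repeat apply Rmult_le_pos.
    + apply Rlt_le, (scaling_pos tauc rbar n T); assumption.
    + now apply He.
    + apply Rlt_le, exp_pos.
    + apply Rmax_l.
Qed.

Lemma continuous_m_1 (tauc rbar Km T : R) (n : nat) (t eta : nat -> R) (x : R) :
  time_grid n T t -> (forall i : nat, (i <= n)%nat -> 0 <= eta i <= 1) ->
  0 < tauc -> 0 < rbar -> 0 < Km -> continuous (m_1 tauc rbar Km n t eta) x.
Proof.
  intros Ht He Hc Hr HK.
  assert (H := c_N_nonneg tauc rbar T n t eta x Ht He Hc Hr).
  apply (continuous_mult (c_N tauc rbar n t eta)
           (fun x => / (Km + c_N tauc rbar n t eta x))).
  - apply continuous_c_N.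
  - apply continuous_Rinv_comp; [|lra].
    apply (continuous_plus (fun _ => Km) (c_N tauc rbar n t eta)).
    + apply continuous_const.
    + apply continuous_c_N.
Qed.

Lemma m_1_nonneg (tauc rbar Km T : R) (n : nat) (t eta : nat -> R) (x : R) :
  time_grid n T t -> (forall i : nat, (i <= n)%nat -> 0 <= eta i <= 1) ->
  0 < tauc -> 0 < rbar -> 0 < Km -> 0 <= m_1 tauc rbar Km n t eta x.
Proof.
  intros Ht He Hc Hr HK.
  assert (H := c_N_nonneg tauc rbar T n t eta x Ht He Hc Hr).
  apply Rdiv_le_0_compat; lra.
Qed.

Lemma continuous_m_2
  (tauc rbar Km tau1 tau2 T : R) (n : nat) (t eta : nat -> R) (x : R) :
  time_grid n T t -> (forall i : nat, (i <= n)%nat -> 0 <= eta i <= 1) ->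
  0 < tauc -> 0 < rbar -> 0 < Km -> 0 < tau1 -> 0 < tau2 ->
  continuous (m_2 tauc rbar Km tau1 tau2 n t eta) x.
Proof.
  intros Ht He Hc Hr HK H1 H2.
  assert (H := m_1_nonneg tauc rbar Km T n t eta x Ht He Hc Hr HK).
  apply (continuous_mult (fun _ => 1)
           (fun x => / (tau1 + tau2 * m_1 tauc rbar Km n t eta x))).
  - apply continuous_const.
  - apply continuous_Rinv_comp; [|nra].
    apply (continuous_plus (fun _ => tau1) (fun x => tau2 * m_1 tauc rbar Km n t eta x)).
    + apply continuous_const.
    + apply (continuous_scal_r tau2 (m_1 tauc rbar Km n t eta)).
      now apply continuous_m_1 with T.
Qed.

Lemma m_2_nonneg
  (tauc rbar Km tau1 tau2 T : R) (n : nat) (t eta : nat -> R) (x : R) :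
  time_grid n T t -> (forall i : nat, (i <= n)%nat -> 0 <= eta i <= 1) ->
  0 < tauc -> 0 < rbar -> 0 < Km -> 0 < tau1 -> 0 < tau2 ->
  0 <= m_2 tauc rbar Km tau1 tau2 n t eta x.
Proof.
  intros Ht He Hc Hr HK H1 H2.
  assert (H := m_1_nonneg tauc rbar Km T n t eta x Ht He Hc Hr HK).
  apply Rdiv_le_0_compat; [lra|nra].
Qed.

Lemma average_nonneg (f : R -> R) (a b : R) :
  a < b -> (forall x : R, continuous f x) -> (forall x : R, 0 <= f x) ->
  0 <= average f a b.
Proof.
  intros Hab Cf Pf. apply Rdiv_le_0_compat; [|lra].
  apply RInt_ge_0; [lra|now apply ex_RInt_of_continuous|auto].
Qed.

(** * The error estimate at the impulse times *)

Theorem proposition22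
  (n : nat) (T : R) (t eta : nat -> R)
  (tauc rbar A Km tau1 tau2 : R)
  (ht : time_grid n T t)
  (heta : forall i : nat, (i <= n)%nat -> 0 <= eta i <= 1)
  (htauc : 0 < tauc) (hrbar : 0 < rbar) (hA : 0 < A)
  (hKm : 0 < Km) (htau1 : 0 < tau1) (htau2 : 0 < tau2)
  (m1 m2 : R -> R)
  (hm1 : m1 = m_1 tauc rbar Km n t eta)
  (hm2 : m2 = m_2 tauc rbar Km tau1 tau2 n t eta)
  (F : R -> R) (hF : is_force A T m1 m2 F)
  (p : nat) (s : nat -> R) (hs : refining_partition n T t p s)
  (m1' m2' : R -> R)
  (hm1'_poly : piecewise_polynomial p s m1')
  (hm2'_poly : piecewise_polynomial p s m2')
  (hm1'_bound : forall x : R, 0 <= x <= T -> 0 <= m1' x <= 1)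
  (hm2'_average : forall j : nat, (j <= n)%nat ->
     forall x : R, t j < x < t (S j) -> m2' x = average m2 (t j) (t (S j)))
  (hm1_concave : forall j : nat, (j <= n)%nat -> concave_on (t j) (t (S j)) m1)
  (hm2_convex : forall j : nat, (j <= n)%nat -> convex_on (t j) (t (S j)) m2) :
  forall k : nat, (k <= n)%nat ->
  Rabs (F (t k) - force_formula A m1' m2' (t k)) / A
  <= RInt (fun x => Rabs (m1 x - m1' x)) 0 (t k)
     + t k * RInt (fun x => Rabs (m2 x - m2' x)) 0 (t k).
Proof.
  intros k Hk.
  assert (C1 : forall x, continuous m1 x).
  { intros x. rewrite hm1. now apply continuous_m_1 with T. }
  assert (C2 : forall x, continuous m2 x).
  { intros x. rewrite hm2. now apply continuous_m_2 with T. }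
  assert (P2 : forall x, 0 <= m2 x).
  { intros x. rewrite hm2. now apply m_2_nonneg with T. }
  destruct ht as (t0 & tT & tlt). destruct hs as (s0 & sT & slt & _).
  assert (tlt' : forall l, (l < S n)%nat -> t l < t (S l)) by (intros; apply tlt; lia).
  assert (Htk : 0 <= t k < T).
  { split.
    - rewrite <- t0. apply (grid_le (S n)); [exact tlt'|lia].
    - apply Rlt_le_trans with (t (S k)); [now apply tlt|].
      rewrite <- tT. apply (grid_le (S n)); [exact tlt'|lia]. }
  assert (C2' := piecewise_polynomial_continuous p s m2' hm2'_poly).
  rewrite (is_force_unique A T m1 m2 F C1 C2 hF (t k) Htk).
  apply (force_formula_stability p s); try assumption.
  - lra.
  - now apply continuous_piecewise.
  - now apply continuous_piecewise.
  - now apply piecewise_polynomial_continuous.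
  - intros u Hu. apply RInt_ge_0; [lra|now apply ex_RInt_of_continuous|auto].
  - (* The sign of [m2'] is known on the pieces of the impulse grid [t], not
       on those of [s], while its integrability comes from [s]. *)
    intros u Hu. apply (RInt_ge_0_grid (S n) t); [exact tlt'| | |lia|lra].
    + rewrite t0, tT, <- s0, <- sT.
      apply piecewise_continuous_ex_RInt with p; [exact slt|exact C2'|lia].
    + intros j Hj x Hx. rewrite (hm2'_average j) by (lia || exact Hx).
      apply average_nonneg; auto.
  - intros u Hu. apply hm1'_bound. lra.
Qed.
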